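(* For every integer $k\geq 1$, every graph of minimum degree at least $2k+1$ contains $k$ cycles of even length whose lengths are pairwise different.
   Context: All graphs are finite and simple. The cycles are not required to be vertex-disjoint. The length of a cycle is its number of vertices. *)

(* Defs.v *)
From mathcomp Require Import all_boot.

Set Implicit Arguments.
Unset Strict Implicit.
Unset Printing Implicit Defensive.

(* A finite simple graph is a symmetric irreflexive relation on a finType. *)

Definition degree (T : finType) (e : rel T) (x : T) : nat :=
  #|[set y | e x y]|.

(* In a simple graph every degree is less than #|T|, so the initial value
   #|T| affects the minimum only when T is empty; the graph without vertices
   then has minimum degree 0. *)
Definition min_degree (T : finType) (e : rel T) : nat :=
  \big[minn/#|T|]_(x : T) degree e x.

(* The sequence lists the vertices of the cycle once each, in cyclic order, so
   its size is the length of the cycle. The bound on the size is needed since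
   [ucycle] also accepts the empty sequence and [:: x; y] for an edge xy. *)
Definition graph_cycle (T : eqType) (e : rel T) (c : seq T) : Prop :=
  2 < size c /\ ucycle e c.

(* Main.v *)
Require Import Defs.
From mathcomp Require Import all_boot.

Set Implicit Arguments.
Unset Strict Implicit.
Unset Printing Implicit Defensive.

(** In a maximum cut every vertex has at least half of its neighbours on the
    other side, so the bipartite graph of the cut edges has minimum degree at
    least k+1. There, the first vertex x of a path that cannot be extended at x
    has all its neighbours on the path. Each of them except the one following x
    closes a cycle with the initial segment it ends; all these cycles are even
    because the graph is bipartite, and their lengths are pairwise different. *)

Section MaxCut.

Variables (T : finType) (e : rel T).
Hypotheses (e_sym : symmetric e) (e_irr : irreflexive e).

Definition cut_rel (s : T -> bool) : rel T := [rel x y | e x y && (s x != s y)].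

Lemma cut_rel_sym s : symmetric (cut_rel s).
Proof. by move=> x y; rewrite /cut_rel /= e_sym eq_sym. Qed.

Definition cut_size (s : T -> bool) : nat := \sum_x \sum_y cut_rel s x y.

Lemma degree_sum (r : rel T) x : degree r x = \sum_y r x y.
Proof. by rewrite /degree -sum1dep_card big_mkcond; apply: eq_bigr => y _; case: (r x y). Qed.

(* Edges are counted in both directions, hence the factor 2. *)
Lemma cut_sizeD1 s v :
  cut_size s = (degree (cut_rel s) v).*2
               + \sum_(x | x != v) \sum_(y | y != v) cut_rel s x y.
Proof.
rewrite /cut_size (bigD1 v) //= -addnn -addnA -!degree_sum; congr (_ + _).
under eq_bigr => x _ do rewrite (bigD1 v) //=.
rewrite big_split /=; congr (_ + _).
have cut_vv : cut_rel s v v = false by rewrite /cut_rel /= e_irr.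
rewrite degree_sum [RHS](bigD1 v) //= cut_vv add0n.
by apply: eq_bigr => x _; rewrite cut_rel_sym.
Qed.

(** Since only [v] changes sides, each edge at [v] is cut by exactly one of [s] and [t]. *)
Lemma degree_cut_flip (s t : T -> bool) v :
  t v = ~~ s v -> (forall x, x != v -> t x = s x) ->
  degree (cut_rel s) v + degree (cut_rel t) v = degree e v.
Proof.
move=> tv tE; rewrite !degree_sum /cut_rel -big_split /=; apply: eq_bigr => y _.
have [->|yv] := eqVneq y v; first by rewrite e_irr.
by rewrite tv tE //; case: (e v y) (s v) (s y) => [] [] [].
Qed.

Lemma max_cut : exists s : T -> bool, forall v, degree e v <= (degree (cut_rel s) v).*2.
Proof.
(* Finite functions form a finite type, so a cut of maximum size exists. *)
pose s : {ffun T -> bool} := [arg max_(s > [ffun=> true] : {ffun T -> bool}) cut_size s].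
have s_max (t : {ffun T -> bool}) : cut_size t <= cut_size s.
  by rewrite /s; case: arg_maxnP => // s' _; apply.
exists s => v; pose t : {ffun T -> bool} := [ffun x => if x == v then ~~ s v else s x].
have tv : t v = ~~ s v by rewrite ffunE eqxx.
have tE x : x != v -> t x = s x by rewrite ffunE => /negPf->.
(* It remains to see that moving [v] across does not increase the number of cut edges at [v]. This
   follows from maximality, as pairs avoiding [v] are unaffected. *)
rewrite -(degree_cut_flip tv tE) -addnn leq_add2l -leq_double.
have := s_max t; rewrite (cut_sizeD1 s v) (cut_sizeD1 t v).
suff -> : \sum_(x | x != v) \sum_(y | y != v) cut_rel t x y =
          \sum_(x | x != v) \sum_(y | y != v) cut_rel s x y by rewrite leq_add2r.
by apply: eq_bigr => x xv; apply: eq_bigr => y yv; rewrite /cut_rel /= !tE.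
Qed.

End MaxCut.

(** Greedy extension at the front must stop, because the vertices of the path stay distinct. *)
Lemma path_not_extendable (T : finType) (e : rel T) (e_sym : symmetric e) (x0 : T) :
  exists x p, [/\ path e x p, uniq (x :: p) & forall y, e x y -> y \in x :: p].
Proof.
(* The induction is on a bound [n] for the number of vertices off the path. *)
have [n] : exists n, #|T| - size [::x0] <= n by exists (#|T| - size [:: x0]).
have : path e x0 [::] && uniq [:: x0] by [].
elim: n x0 [::] => [|n IHn] x p /andP[xp Up] le_n;
  have [/existsP[y /andP[exy y_p]]|/existsPn p_max] :=
    boolP [exists y, e x y && (y \notin x :: p)].
- have : uniq [:: y, x & p] by rewrite cons_uniq y_p.
  move/card_uniqP => eq_sz; have := max_card [in [:: y, x & p]].
  by rewrite eq_sz ltnNge -subn_eq0 -leqn0 le_n.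
- by exists x, p; split=> // y exy; have := p_max y; rewrite exy negbK.
- apply: (IHn y (x :: p)); first by rewrite cons_uniq y_p Up /= e_sym exy xp.
  by move: le_n; rewrite /= !leq_subLR !addSn addnS.
- by exists x, p; split=> // y exy; have := p_max y; rewrite exy negbK.
Qed.

Lemma bipartite_path_last (T : eqType) (e : rel T) (s : T -> bool) x p :
  (forall y z, e y z -> s y != s z) -> path e x p ->
  s (last x p) = s x (+) odd (size p).
Proof.
move=> e_bip; elim: p x => [|y p IHp] x /=; first by rewrite addbF.
by case/andP=> /e_bip + /IHp->; case: (s x) (s y) => [] [] // _; case: odd.
Qed.

Lemma bipartite_even_cycles (T : finType) (e : rel T) (s : T -> bool) (k : nat) :
  symmetric e -> (forall x y, e x y -> s x != s y) ->
  (forall x, k < degree e x) -> 0 < #|T| ->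
  exists C : 'I_k -> seq T,
    (forall i, graph_cycle e (C i) /\ ~~ odd (size (C i))) /\
    (forall i j, i <> j -> size (C i) <> size (C j)).
Proof.
move=> e_sym e_bip deg_gt /card_gt0P[x0 _].
have [x [p [xp Up p_max]]] := path_not_extendable e_sym x0.
have e_in_p y : e x y -> y \in p.
  move=> exy; have := p_max y exy; rewrite inE => /orP[/eqP yx|//].
  by have := e_bip _ _ exy; rewrite yx eqxx.
(* The edge from [x] to [head x p] lies on the path and closes no cycle. The default [x] never
   occurs: [x] has a neighbour, so [p] is nonempty. *)
pose N := [set y | e x y] :\ head x p.
have leN : k <= #|N|.
  have := deg_gt x; rewrite /degree (cardsD1 (head x p)) -/N.
  by case: (_ \in _) => // /ltnW.
pose v (i : 'I_k) := enum_val (widen_ord leN i).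
have vN i : e x (v i) /\ v i != head x p.
  by have := enum_valP (widen_ord leN i); rewrite !inE => /andP[].
have index_v i : index (v i) p < size p by rewrite index_mem e_in_p //; case: (vN i).
(* The length is the index of [v i] in [p] plus 2. *)
exists (fun i => x :: take (index (v i) p).+1 p); split=> [i|i j ij].
  have [exv v_head] := vN i; set q := take _ _.
  have size_q : size q = (index (v i) p).+1 by rewrite size_takel.
  have last_q : last x q = v i.
    by rewrite (last_nth x) size_q /= nth_take // nth_index // e_in_p.
  have xq : path e x q by apply: take_path.
  (* The ends [x] and [v i] of the segment are on opposite sides, so it has an odd number of
     edges. *)
  have odd_q : odd (size q).
    have := bipartite_path_last e_bip xq; rewrite last_q.
    by have := e_bip _ _ exv; case: (s x) (s (v i)) (odd _) => [] [] [].
  rewrite /= odd_q; split=> //; split.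
    (* Fewer than three vertices would mean index 0, that is [v i = head x p]. *)
    rewrite /= size_q !ltnS lt0n; apply: contra v_head => /eqP i0.
    by rewrite -nth0 -i0 nth_index // e_in_p.
  rewrite /ucycle /cycle rcons_path xq last_q e_sym exv /=.
  by have := take_uniq (size q).+1 Up; rewrite /= size_q.
rewrite /= !size_takel // => -[eq_ij]; apply: ij.
have /enum_val_inj/(congr1 val)/= : v i = v j.
  have [[ei _] [ej _]] := (vN i, vN j).
  by rewrite -(nth_index x (e_in_p _ ei)) eq_ij nth_index // e_in_p.
exact: val_inj.
Qed.

Lemma bigminn_le (I : eqType) (r : seq I) (F : I -> nat) (n : nat) (i : I) :
  i \in r -> \big[minn/n]_(j <- r) F j <= F i.
Proof.
elim: r => // j r IHr; rewrite inE big_cons geq_min.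
by case/predU1P=> [->|/IHr->]; rewrite ?leqnn ?orbT.
Qed.

Theorem theorem2p3 (k : nat) (k_ge1 : 1 <= k)
    (T : finType) (e : rel T) (e_sym : symmetric e) (e_irr : irreflexive e)
    (min_deg : 2 * k + 1 <= min_degree e) :
  exists C : 'I_k -> seq T,
    (forall i : 'I_k, graph_cycle e (C i) /\ ~~ odd (size (C i))) /\
    (forall i j : 'I_k, i <> j -> size (C i) <> size (C j)).
Proof.
have min_degree_le x : min_degree e <= degree e x.
  exact: bigminn_le (mem_index_enum x).
(* For empty [T] the minimum is its initial value [#|T|], which is 0. *)
have T_gt0 : 0 < #|T|.
  case: posnP => // /card0_eq T0; move: min_deg.
  by rewrite /min_degree big_pred0 // eq_card0 // addn1.
have [s s_half] := max_cut e_sym e_irr.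
have deg_cut x : k < degree (cut_rel e s) x.
  (* Twice the cut degree is at least [2 * k + 1], hence exceeds [2 * k]. *)
  rewrite -ltn_double; apply: leq_trans (s_half x).
  by apply: leq_trans (min_degree_le x); rewrite -mul2n -addn1.
have cut_bip x y : cut_rel e s x y -> s x != s y by case/andP.
have [C [C_cycle C_size]] :=
  bipartite_even_cycles (cut_rel_sym e_sym s) cut_bip deg_cut T_gt0.
exists C; split=> // i; have [[size_C /andP[cycle_C uniq_C]] even_C] := C_cycle i.
split=> //; split=> //; rewrite /ucycle uniq_C andbT.
by apply: sub_cycle cycle_C => x y /andP[].
Qed.
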